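(* Let $H\in(0,1)$, $\alpha>0$, let $S_H$ be a sub-fractional Brownian motion with index $H$, and let $S_H^{\mathrm{LT}}(t)=e^{-\alpha H t}S_H(e^{\alpha t})$ for $t\in\mathbb{R}$. Then the autocovariance function of $S_H^{\mathrm{LT}}$ is $$R_{S,\alpha}(t):=\mathbb{E}\bigl[S_H^{\mathrm{LT}}(t)S_H^{\mathrm{LT}}(0)\bigr]=e^{-\alpha H t}\Bigl(e^{2\alpha H t}+1-\tfrac12\bigl[(e^{\alpha t}+1)^{2H}+(e^{\alpha t}-1)^{2H}\bigr]\Bigr),\qquad t\in\mathbb{R}.$$
   Context: A sub-fractional Brownian motion $S_H=\{S_H(t)\}_{t\ge 0}$ with index $H\in(0,1)$ is a centred Gaussian process with covariance $$\mathbb{E}[S_H(s)S_H(t)]=s^{2H}+t^{2H}-\tfrac12\bigl((s+t)^{2H}+|t-s|^{2H}\bigr),\qquad s,t\ge0.$$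
   Formalization: The term (e^{αt}-1)^{2H} is replaced by |e^{αt}-1|^{2H}, since for t<0 the base is negative and the power is undefined or gives a wrong value (e.g. H=1/2); for t≥0 the formula is unchanged. *)

(* Defs.v *)
From HB Require Import structures.
From mathcomp Require Import all_boot all_order all_algebra.
From mathcomp Require Import all_classical all_reals all_analysis.

Set Implicit Arguments.
Unset Strict Implicit.
Unset Printing Implicit Defensive.

Import Order.TTheory GRing.Theory Num.Theory.
Import numFieldNormedType.Exports.

Local Open Scope classical_set_scope.
Local Open Scope ring_scope.

(* Dirac masses are degenerate Gaussian laws. They form a separate case because
   [normal_prob m 0] is not [\d_m]: [normal_pdf m 0] is the indicator of [0, 1]. *)
Definition gaussian_law (R : realType) (mu : set R -> \bar R) : Prop :=
  exists m : R,
    (forall A : set R, measurable A -> mu A = \d_m A) \/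
    (exists2 s : R, 0 < s &
      forall A : set R, measurable A -> mu A = normal_prob m s A).

Definition gaussian_process (d : measure_display) (T : measurableType d)
    (R : realType) (P : probability T R) (I : Type)
    (X : I -> {RV P >-> R}) : Prop :=
  forall (n : nat) (t : 'I_n -> I) (c : 'I_n -> R),
    gaussian_law (pushforward P (fun w : T => \sum_(i < n) c i * X (t i) w)).

Arguments gaussian_process {d T R} P {I} X.

Definition centred (d : measure_display) (T : measurableType d)
    (R : realType) (P : probability T R) (I : Type)
    (X : I -> {RV P >-> R}) : Prop :=
  forall t : I, 'E_P[X t]%E = 0%E.

Arguments centred {d T R} P {I} X.

Definition sub_fBm_cov (R : realType) (H s t : R) : R :=
  s `^ (2 * H) + t `^ (2 * H)
  - 2^-1 * ((s + t) `^ (2 * H) + `|t - s| `^ (2 * H)).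

Record sub_fBm (d : measure_display) (T : measurableType d)
    (R : realType) (P : probability T R) (H : R)
    (S : {nonneg R} -> {RV P >-> R}) : Prop := {
  sub_fBm_gaussian : gaussian_process P S;
  sub_fBm_centred : centred P S;
  sub_fBm_covE : forall s t : {nonneg R},
    'E_P[(fun w : T => S s w * S t w)%R]%E = (sub_fBm_cov H s%:num t%:num)%:E }.

Arguments sub_fBm {d T R} P H S.

Definition lamperti (d : measure_display) (T : measurableType d)
    (R : realType) (P : probability T R) (alpha H : R)
    (S : {nonneg R} -> {RV P >-> R}) (t : R) : T -> R :=
  fun w => expR (- (alpha * H * t)) * S (NngNum (expR_ge0 (alpha * t))) w.

Arguments lamperti {d T R P} alpha H S t.

Definition autocovariance (d : measure_display) (T : measurableType d)
    (R : realType) (P : probability T R) (Y : R -> T -> R) (t : R) : \bar R :=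
  'E_P[(fun w : T => Y t w * Y 0 w)%R]%E.

(* Main.v *)
Require Import Defs.
From HB Require Import structures.
From mathcomp Require Import all_boot all_order all_algebra.
From mathcomp Require Import all_classical all_reals all_analysis.
From mathcomp Require Import measurable_realfun.

Import Order.TTheory GRing.Theory Num.Theory.
Import numFieldNormedType.Exports.

Local Open Scope classical_set_scope.
Local Open Scope ring_scope.

(** The Lamperti transform samples [S] at [expR (alpha * t)] and, at time 0, at 1 with prefactor 1.
    The remaining deterministic factor leaves the expectation, and the covariance of [S] at these
    two points gives the formula. The absolute value inherited from this covariance gives meaning to
    the last power when [t < 0]. *)

(* If both parts of [f] have infinite integral, both sides are
   [k * (+oo - +oo) = -oo] (or [0] if [k = 0]). *)
Lemma ge0_integralZl_measurable (d : measure_display) (T : measurableType d)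
    (R : realType) (mu : measure T R) (D : set T) (mD : measurable D)
    (f : T -> \bar R) (mf : measurable_fun D f) (k : R) (k_ge0 : 0 <= k) :
  (\int[mu]_(x in D) (k%:E * f x) = k%:E * \int[mu]_(x in D) f x)%E.
Proof.
rewrite integralE [in RHS]integralE ge0_funeposM // ge0_funenegM //.
rewrite !ge0_integralZl_EFin //; last 2 first.
  exact: measurable_funeneg.
  exact: measurable_funepos.
move: k_ge0; rewrite le_eqVlt => /predU1P[<-|k_gt0].
  by rewrite !mul0e sube0.
(* Nonnegativity rules out [-oo], leaving each part finite or [+oo]; scaling by [k > 0] preserves
   either alternative. *)
have : (0 <= \int[mu]_(x in D) f^\+ x)%E by apply: integral_ge0.
have : (0 <= \int[mu]_(x in D) f^\- x)%E by apply: integral_ge0.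
case: (\int[mu]_(x in D) f^\- x)%E => [b| |] // _;
  case: (\int[mu]_(x in D) f^\+ x)%E => [a| |] // _.
- by rewrite muleBr.
- by rewrite /= gt0_muley ?lte_fin.
- by rewrite /= gt0_muley ?gt0_muleNy ?lte_fin.
- by rewrite /= gt0_muley ?gt0_muleNy ?lte_fin.
Qed.

Theorem theorem2p6 (d : measure_display) (T : measurableType d) (R : realType)
    (P : probability T R) (H alpha : R) (S : {nonneg R} -> {RV P >-> R})
    (H_gt0 : 0 < H) (H_lt1 : H < 1) (alpha_gt0 : 0 < alpha)
    (S_sub_fBm : sub_fBm P H S) (t : R) :
  autocovariance P (lamperti alpha H S) t =
  (expR (- (alpha * H * t)) *
   (expR (2 * alpha * H * t) + 1
    - 2^-1 * ((expR (alpha * t) + 1) `^ (2 * H)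
              + `|expR (alpha * t) - 1| `^ (2 * H))))%:E.
Proof.
rewrite /autocovariance /lamperti mulr0 oppr0 expR0.
set s := NngNum (expR_ge0 (alpha * t)); set u := NngNum (expR_ge0 (alpha * 0)).
have u1 : u%:num = 1 by rewrite /= mulr0 expR0.
have := sub_fBm_covE S_sub_fBm s u.
rewrite unlock => cov_su.
under eq_integral do rewrite mul1r -mulrA EFinM.
(* Measurability of the product is enough here, so its integrability need not be extracted from the
   Gaussian law. *)
rewrite ge0_integralZl_measurable ?expR_ge0 //; last first.
  by apply/measurable_EFinP; apply: measurable_funM; exact: measurable_funPT.
(* [distrC] turns the increment from [expR (alpha * t)] to 1 into the stated
   [expR (alpha * t) - 1]. *)
rewrite cov_su -EFinM /sub_fBm_cov u1 powR1 distrC /= -expRM.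
by rewrite [alpha * t * _]mulrC mulrACA mulrA.
Qed.
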